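(* Let $\nu$ be a probability measure on $\{-1,1\}^n$, let $(\nu_t)_t$ be its coordinate-by-coordinate localization process, and let $\kappa>0$. (1) For every integer $t\in\{0,1,\dots,n-1\}$, if the measure $\nu_t$ is $\kappa$-entropically stable with respect to the function $\psi(x,y)=H(x,y)$, then for all $f:\{-1,1\}^n\to\mathbb R_+$, $$\mathbb E\bigl[\mathrm{Ent}_{\nu_{t+1}}[f]\,\big|\,\nu_t\bigr]\ge\Bigl(1-\frac{\kappa}{n-t}\Bigr)\mathrm{Ent}_{\nu_t}[f].$$ (2) Consequently, if $\mathcal R_u\nu$ is $\kappa$-entropically stable with respect to $\psi(x,y)=H(x,y)$ for all $u\in\{-1,0,1\}^n$, then the $\ell$-Glauber dynamics $P=P^{\mathrm{GD},\ell}(\nu)$ has MLSI coefficient $$\rho_{\mathrm{LS}}(P)\ge\prod_{i=0}^{n-\ell-1}\Bigl(1-\frac{\kappa}{n-i}\Bigr).$$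
   Context: Coordinate-by-coordinate localization process: let $(k_1,\dots,k_n)$ be a uniformly random permutation of $\{1,\dots,n\}$ and $X\sim\nu$ independent of it; $\nu_t$ is the law of $X$ conditioned on $X_{k_1},\dots,X_{k_i}$ (and on $k_1,\dots,k_i$), $i=\min(\lfloor t\rfloor,n)$. Conditioning on $\nu_t$ means conditioning on the information revealed up to time $t$. For $u\in\{-1,0,1\}^n$, the pinning $\mathcal R_u\nu$ is the normalized restriction of $\nu$ to $S_u=\{x\in\{-1,1\}^n:x_iu_i\ge0\ \forall i\}$ (only $u$ with $\nu(S_u)>0$ are considered). For $x,y\in[-1,1]^n$, $$H(x,y)=\sum_{i=1}^n\mathbf 1_{|y_i|<1}\left(\frac{1+x_i}2\log\frac{1+x_i}{1+y_i}+\frac{1-x_i}2\log\frac{1-x_i}{1-y_i}\right)$$ with $0\log0=0$. Entropic stability: for a measure $\nu$, $\mathbf b(\nu)=\int x\,d\nu(x)$ is the center of mass, the tilt $\mathcal T_v\nu$ is given by $\frac{d\mathcal T_v\nu}{d\nu}(x)=\frac{e^{\langle v,x\rangle}}{\int e^{\langle v,z\rangle}d\nu(z)}$, and $\nu$ is $\kappa$-entropically stable with respect to $\psi$ if $\psi(\mathbf b(\mathcal T_v\nu),\mathbf b(\nu))\le\kappa\,\mathrm{D_{KL}}(\mathcal T_v\nu\|\nu)$ for all $v\in\mathbb R^n$, where $\mathrm{D_{KL}}(\mu\|\nu)=\int\log\frac{d\mu}{d\nu}d\mu$. $\ell$-Glauber dynamics ($\ell$ an integer, $1\le\ell\le n$):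 from state $x$, choose $A\subset\{1,\dots,n\}$ with $|A|=\ell$ uniformly at random and move to a point sampled from $\nu$ conditioned on $\{y:y_i=x_i\ \forall i\notin A\}$. $\mathrm{Ent}_\nu[f]=\int f\log f\,d\nu-\int f\,d\nu\,\log\int f\,d\nu$; the MLSI (modified log-Sobolev) coefficient of a reversible kernel $P$ with stationary measure $\nu$ is $\rho_{\mathrm{LS}}(P)=1-\sup_f\frac{\mathrm{Ent}_\nu[Pf]}{\mathrm{Ent}_\nu[f]}$ over $f\ge0$ with $\mathrm{Ent}_\nu[f]>0$.
   Formalization: In (2) each factor 1−κ/(n−i) is replaced by its positive part max(0, 1−κ/(n−i)), since the literal product can exceed 1 ≥ ρ when an even number of factors are negative (uniform ν, n=3, ℓ=1, κ=8 gives 5). *)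

(* Defs.v *)
From HB Require Import structures.
From mathcomp Require Import all_boot all_order all_algebra all_fingroup.
From mathcomp Require Import boolp classical_sets reals ereal sequences exp.

Set Implicit Arguments.
Unset Strict Implicit.
Unset Printing Implicit Defensive.

Import Order.TTheory GRing.Theory Num.Theory.
Local Open Scope ring_scope.

Section FiniteMeasures.
Variables (R : realType) (T : finType).
Implicit Types (mu : T -> R) (f : T -> R) (A : {set T}).

Definition is_prob mu : Prop := (forall x, 0 <= mu x) /\ \sum_x mu x = 1.

Definition mass mu A : R := \sum_(x in A) mu x.

(* The null measure when [mass mu A = 0]. *)
Definition cond mu A : T -> R :=
  fun x => if x \in A then mu x / mass mu A else 0.

Definition expect mu f : R := \sum_x mu x * f x.

(* [ln 0 = 0] in the library, hence 0 log 0 = 0. *)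
Definition Ent mu f : R :=
  expect mu (fun x => f x * ln (f x)) - expect mu f * ln (expect mu f).

(* The relative entropy of [mu] with respect to [nu], for [mu] absolutely
   continuous with respect to [nu]; tilts of [nu] always are. *)
Definition KL mu nu : R := expect mu (fun x => ln (mu x / nu x)).

Definition kernel_app (P : T -> T -> R) f : T -> R := fun x => expect (P x) f.

(* The supremum is taken in the extended reals, so that it is a genuine least
   upper bound in all cases; the coefficient is +oo when no [f] is admissible
   (i.e. when [mu] is a Dirac mass). *)
Definition mlsi (P : T -> T -> R) mu : \bar R :=
  (1 - ereal_sup [set (Ent mu (kernel_app P f) / Ent mu f)%:E |
                  f in [set f : T -> R | (forall x, 0 <= f x)%R
                                         /\ (0 < Ent mu f)%R]]%classic)%E.

End FiniteMeasures.

(* The points of {-1,1}^n: [true] encodes 1 and [false] encodes -1. *)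
Definition cube (n : nat) := {ffun 'I_n -> bool}.

Definition pt (R : realType) (n : nat) (x : cube n) : 'rV[R]_n :=
  \row_i (if x i then 1 else -1).

Section Cube.
Variables (R : realType) (n : nat).
Implicit Types (nu : cube n -> R) (u v : 'rV[R]_n).

Definition pin_set u : {set cube n} :=
  [set x | [forall i, 0 <= pt R x 0 i * u 0 i]].

Definition pinning u nu : cube n -> R := cond nu (pin_set u).

Definition H (x y : 'rV[R]_n) : R :=
  \sum_(i < n | `|y 0 i| < 1)
     ((1 + x 0 i) / 2 * ln ((1 + x 0 i) / (1 + y 0 i))
      + (1 - x 0 i) / 2 * ln ((1 - x 0 i) / (1 - y 0 i))).

Definition barycenter nu : 'rV[R]_n := \sum_x nu x *: pt R x.

Definition dotp u v : R := \sum_i u 0 i * v 0 i.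

Definition tilt v nu : cube n -> R :=
  fun x => nu x * expR (dotp v (pt R x))
           / expect nu (fun z => expR (dotp v (pt R z))).

Definition entropically_stable (kappa : R)
    (psi : 'rV[R]_n -> 'rV[R]_n -> R) nu : Prop :=
  forall v, psi (barycenter (tilt v nu)) (barycenter nu)
            <= kappa * KL (tilt v nu) nu.

(* Only the rows [x] with [nu x > 0] are meaningful: for the others the
   conditioning event may be null. *)
Definition glauber (l : nat) nu : cube n -> cube n -> R :=
  fun x y => ('C(n, l)%:R)^-1 *
    \sum_(A : {set 'I_n} | #|A| == l)
       cond nu [set z : cube n | [forall i, (i \notin A) ==> (z i == x i)]] y.

(* An outcome (k, x) of the experiment is a uniform permutation k together with
   an independent sample x of [nu]; coordinates are revealed in the order
   k 0, k 1, ... *)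
Definition outcome := ({perm 'I_n} * cube n)%type.

Definition joint nu : outcome -> R :=
  fun w => (#|{perm 'I_n}|%:R)^-1 * nu w.2.

Definition nrevealed (t : R) : nat := minn (Num.truncn t) n.

(* The atom containing [w] of the information revealed up to time [t]. *)
Definition info (t : R) (w : outcome) : {set outcome} :=
  [set w' : outcome | [forall j : 'I_n, (j < nrevealed t)%N ==>
       (w'.1 j == w.1 j) && (w'.2 (w'.1 j) == w.2 (w.1 j))]].

(* The random measure nu_t, evaluated at the outcome [w]. *)
Definition localization nu (t : R) (w : outcome) : cube n -> R :=
  fun y => mass (cond (joint nu) (info t w)) [set w' : outcome | w'.2 == y].

(* The conditional expectation of [Z] given nu_t, at the outcome [w]. *)
Definition cond_expect nu (t : R) (Z : outcome -> R) (w : outcome) : R :=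
  expect (cond (joint nu) (info t w)) Z.

End Cube.

(* Main.v *)
Require Import Defs.
From HB Require Import structures.
From mathcomp Require Import all_boot all_order all_algebra all_fingroup.
From mathcomp Require Import boolp classical_sets reals ereal sequences exp.
From mathcomp Require Import ring lra.

(** Let mu be a kappa-entropically stable law on the cube and f >= 0.  Revealing
    one coordinate i splits the entropy by the chain rule

      Ent_mu f = Ent_mu (E[f | x_i]) + E Ent_{mu( . | x_i)} f,

    and the first term is E_mu f times the relative entropy of two Bernoulli
    laws, namely the i-th marginals of the measure rho with density f / E_mu f
    and of mu ([Ent_cexp1]).  Summed over i, these relative entropies are exactly
    H (b rho) (b mu).  Stability therefore bounds the total entropy explained by
    single coordinates by kappa Ent_mu f ([sum_Ent_cexp1]), and revealing a
    coordinate uniform among the m = n - t hidden ones costs on average at most a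
    fraction kappa / m of the entropy ([local_step]).

    Stability, however, only speaks of tilts of mu, whereas rho is an arbitrary
    measure absolutely continuous with respect to mu.  The reduction
    ([stable_density]) is that a tilt minimizes the relative entropy for a given
    barycenter.  Since b rho may lie on the boundary of the set of barycenters,
    where no tilt attains it, an approximation is needed.  Adding a small
    quadratic penalty to the convex function ln Z v - <v, b rho>, whose infimum is
    at least - KL rho mu by the Gibbs variational principle, a near-minimizer v
    satisfies KL (tilt v mu) mu <= KL rho mu + d and has a barycenter d-close to
    b rho ([tilt_approx]).  As H( . , b mu) is a supremum of affine functions, it is
    lower semicontinuous ([H_lsc]) and the bound passes to the limit d -> 0.

    The inequality for the localization process is [local_step] once its law is
    made explicit: given the first t revealed coordinates, the measure is nu
    conditioned on a cylinder ([localizationE]) and the next coordinate is uniform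
    among the others ([next_uniform]).

    For the Glauber dynamics, let D_t be the average over the t-sets S of the
    expected entropy of f given x_S.  Then D_0 = Ent f, and averaging [local_step]
    gives D_(t+1) >= (1 - kappa / (n - t)) D_t.  One step of the l-Glauber dynamics
    averages E[f | x_(~: A)] over the l-sets A, so by convexity of the entropy and
    the chain rule Ent (P f) <= Ent f - D_(n-l) ([Ent_glauber]).

    The elementary inequality [relent_tangent], the tangent line bound for the
    convex function a ln (a / b), yields in turn the log-sum inequality (hence
    nonnegativity and convexity of the entropy and the Gibbs principle) and the
    affine minorants of H. *)

Set Implicit Arguments.
Unset Strict Implicit.
Unset Printing Implicit Defensive.

Import Order.TTheory GRing.Theory Num.Theory.
Local Open Scope ring_scope.

(** * Relative entropy on finite sets *)

Section RelativeEntropy.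
Variable R : realType.

(** The pointwise contribution to a relative entropy; every entropy below is a
    sum of such terms, so that inequalities reduce to statements about [relent]. *)
Definition relent (a b : R) : R := a * ln (a / b).

Lemma relent0l b : relent 0 b = 0.
Proof. by rewrite /relent mul0r. Qed.

Lemma relent_scale c a b : 0 <= c -> relent (c * a) (c * b) = c * relent a b.
Proof.
rewrite /relent le_eqVlt => /orP[/eqP <-|c0]; first by rewrite !mul0r.
by rewrite -mulf_div divff ?gt_eqF// mul1r mulrA.
Qed.

(** Since a ln (a / b) = sup_s (a ln s + a - s b), with the supremum reached at
    s = a / b.  The bound is ln z <= z - 1 at z = s b / a. *)
Lemma relent_tangent s a b : 0 < s -> 0 <= a -> 0 <= b -> (b = 0 -> a = 0) ->
  a * ln s + a - s * b <= relent a b.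
Proof.
move=> s0; rewrite le_eqVlt => /orP[/eqP <- b0 _|a0].
  by rewrite relent0l mul0r !add0r oppr_le0 mulr_ge0// ltW.
rewrite le_eqVlt => /orP[/eqP <- /(_ erefl) a00|b0 _].
  by rewrite a00 ltxx in a0.
have z0 : 0 < s * (b / a) by rewrite mulr_gt0// divr_gt0.
have := @le_ln1Dx R (s * (b / a) - 1).
rewrite ltrBrDl subrr z0 => /(_ isT); rewrite addrC subrK.
rewrite lnM ?posrE ?divr_gt0// => /(ler_wpM2l (ltW a0)).
rewrite mulrDr mulrBr mulr1 (_ : a * (s * (b / a)) = s * b); last first.
  by field; rewrite gt_eqF.
rewrite /relent !ln_div ?posrE// !mulrBr; lra.
Qed.

(** Add up the tangent bounds with the common slope s = sum a / sum b. *)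
Lemma log_sum (I : finType) (P : pred I) (a b : I -> R) :
  (forall i, P i -> 0 <= a i) -> (forall i, P i -> 0 <= b i) ->
  (forall i, P i -> b i = 0 -> a i = 0) ->
  relent (\sum_(i | P i) a i) (\sum_(i | P i) b i)
    <= \sum_(i | P i) relent (a i) (b i).
Proof.
move=> a0 b0 ab.
have [A0|A0] := eqVneq (\sum_(i | P i) a i) 0.
  rewrite A0 relent0l big1// => i Pi.
  by rewrite (psumr_eq0P a0 A0) ?relent0l.
set A := \sum_(i | P i) a i; set B := \sum_(i | P i) b i.
have Apos : 0 < A by rewrite lt_neqAle eq_sym A0 sumr_ge0.
have Bpos : 0 < B.
  rewrite lt_neqAle sumr_ge0// andbT eq_sym; apply: contra_neq A0 => B0.
  by apply: big1 => i Pi; apply: ab => //; apply: (psumr_eq0P b0 B0).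
have s0 : 0 < A / B by rewrite divr_gt0.
apply: le_trans (ler_sum _ (fun i Pi =>
  relent_tangent s0 (a0 i Pi) (b0 i Pi) (ab i Pi))).
rewrite big_split/= big_split/= sumrN -mulr_suml -mulr_sumr -/A -/B.
by rewrite divfK ?gt_eqF// addrK.
Qed.

Section Ent.
Variable T : finType.
Implicit Types (mu f : T -> R) (A : {set T}).

Lemma KL_relent mu nu : @KL R T mu nu = \sum_x relent (mu x) (nu x).
Proof. by []. Qed.

Lemma expect_ge0 mu f : (forall x, 0 <= mu x) -> (forall x, 0 <= f x) ->
  0 <= expect mu f.
Proof. by move=> m0 f0; apply: sumr_ge0 => x _; apply: mulr_ge0. Qed.

Lemma expect_eq0 mu f : (forall x, 0 <= mu x) -> (forall x, 0 <= f x) ->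
  expect mu f = 0 -> forall x, mu x * f x = 0.
Proof.
move=> m0 f0 E0 x; apply: (psumr_eq0P _ E0) => // y _; exact: mulr_ge0.
Qed.

(** The entropy of f compares f mu with the measure of the same mass proportional
    to mu.  In this form it is jointly homogeneous, and the log-sum inequality
    applies to it. *)
Lemma Ent_relent mu f : (forall x, 0 <= mu x) -> (forall x, 0 <= f x) ->
  Ent mu f = \sum_x relent (mu x * f x) (mu x * expect mu f).
Proof.
move=> m0 f0; rewrite /Ent {1 2}/expect mulr_suml -sumrB.
apply: eq_bigr => x _.
have [->|mx] := eqVneq (mu x) 0; first by rewrite !mul0r relent0l subrr.
have [->|fx] := eqVneq (f x) 0; first by rewrite !(mulr0, mul0r) relent0l subrr.
rewrite relent_scale// /relent ln_div ?posrE ?lt_neqAle 1?eq_sym ?fx ?f0//.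
  by rewrite mulrBr mulrBr !mulrA.
rewrite eq_sym expect_ge0// andbT; apply/eqP => /esym E0.
by have /eqP := expect_eq0 m0 f0 E0 x; rewrite mulf_eq0 (negbTE mx) (negbTE fx).
Qed.

Lemma Ent_ge0 mu f : is_prob mu -> (forall x, 0 <= f x) -> 0 <= Ent mu f.
Proof.
move=> [m0 m1] f0; rewrite Ent_relent//.
have e : relent (expect mu f) (expect mu f) = 0.
  have [->|E0] := eqVneq (expect mu f) 0; first by rewrite relent0l.
  by rewrite /relent divff// ln1 mulr0.
rewrite -[X in X <= _]e -[X in relent _ X <= _]mul1r -m1 mulr_suml.
rewrite [X in relent X _ <= _]/expect.
apply: log_sum => x _; rewrite ?mulr_ge0 ?expect_ge0//.
by move/eqP; rewrite mulf_eq0 => /orP[/eqP ->|/eqP /expect_eq0 ->//]; rewrite mul0r.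
Qed.

(** The log-sum inequality at each point x, over the index i. *)
Lemma Ent_convex (I : finType) (w : I -> R) mu (g : I -> T -> R) :
  (forall x, 0 <= mu x) -> (forall i, 0 <= w i) -> (forall i x, 0 <= g i x) ->
  Ent mu (fun x => \sum_i w i * g i x) <= \sum_i w i * Ent mu (g i).
Proof.
move=> m0 w0 g0.
have G0 x : 0 <= \sum_i w i * g i x by apply: sumr_ge0 => i _; rewrite mulr_ge0.
have eE : expect mu (fun x => \sum_i w i * g i x)
          = \sum_i w i * expect mu (g i).
  under [RHS]eq_bigr do rewrite mulr_sumr.
  rewrite exchange_big; apply: eq_bigr => x _.
  by rewrite mulr_sumr; apply: eq_bigr => i _; rewrite mulrCA.
rewrite Ent_relent// eE.
have -> : \sum_i w i * Ent mu (g i) = \sum_x \sum_i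
    relent (mu x * (w i * g i x)) (mu x * (w i * expect mu (g i))).
  rewrite exchange_big; apply: eq_bigr => i _.
  rewrite Ent_relent// mulr_sumr; apply: eq_bigr => x _.
  by rewrite -relent_scale// !(mulrCA (w i)).
apply: ler_sum => x _; rewrite !mulr_sumr.
apply: log_sum => i _; rewrite ?mulr_ge0// ?expect_ge0//.
move/eqP; rewrite !mulf_eq0 => /or3P[/eqP->|/eqP->|/eqP E0]; rewrite ?(mul0r,mulr0)//.
by rewrite mulrCA (expect_eq0 m0 (g0 i) E0) mulr0.
Qed.

End Ent.
End RelativeEntropy.

(** * Exponential tilts *)

Section Tilts.
Variables (R : realType) (n : nat).
Implicit Types (mu rho : cube n -> R) (u v : 'rV[R]_n).

Lemma barycenterE mu i : barycenter mu 0 i = expect mu (fun x => pt R x 0 i).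
Proof. by rewrite /barycenter summxE; apply: eq_bigr => x _; rewrite mxE. Qed.

Lemma pt_cases (x : cube n) i : pt R x 0 i = 1 \/ pt R x 0 i = -1.
Proof. by rewrite mxE; case: (x i); [left|right]. Qed.

Lemma barycenter_itv mu i : is_prob mu ->
  -1 <= barycenter mu 0 i <= 1.
Proof.
move=> [m0 m1]; rewrite barycenterE -ler_norml -m1 /expect.
apply: le_trans (ler_norm_sum _ _ _) _; apply: ler_sum => x _.
rewrite normrM ger0_norm//; case: (pt_cases x i) => ->.
  by rewrite normr1 mulr1.
by rewrite normrN1 mulr1.
Qed.

Lemma dotpDl u v w : dotp (u + v) w = dotp u w + dotp v w :> R.
Proof. by rewrite -big_split; apply: eq_bigr => i _; rewrite mxE mulrDl. Qed.

Lemma dotp0l u : dotp 0 u = 0 :> R.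
Proof. by rewrite /dotp big1// => i _; rewrite mxE mul0r. Qed.

Lemma dotp_delta (h : R) i u : dotp (h *: delta_mx 0 i) u = h * u 0 i.
Proof.
rewrite /dotp (bigD1 i)//= big1 ?addr0 => [|j ji]; rewrite !mxE !eqxx/=.
  by rewrite mulr1.
by rewrite (negbTE ji) mulr0 mul0r.
Qed.

Lemma dotp_barycenter v mu :
  dotp v (barycenter mu) = expect mu (fun x => dotp v (pt R x)).
Proof.
rewrite /dotp /expect; under [RHS]eq_bigr do rewrite mulr_sumr.
rewrite exchange_big; apply: eq_bigr => i _.
rewrite barycenterE mulr_sumr; apply: eq_bigr => x _.
by rewrite mulrCA.
Qed.

Definition laplace mu v : R := expect mu (fun z => expR (dotp v (pt R z))).

Section Fixed.
Variable mu : cube n -> R.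
Hypothesis Pmu : is_prob mu.

Lemma laplace_gt0 v : 0 < laplace mu v.
Proof.
case: Pmu => m0 m1.
have E0 : 0 <= laplace mu v.
  by apply: expect_ge0 => // x; rewrite expR_ge0.
rewrite lt_neqAle E0 andbT; apply/eqP => /esym H0.
have := @oner_neq0 R; rewrite -m1 big1 ?eqxx// => x _.
have /eqP := expect_eq0 m0 (fun x => expR_ge0 _) H0 x.
by rewrite mulf_eq0 (gt_eqF (expR_gt0 _)) orbF => /eqP.
Qed.

Lemma tilt_prob v : is_prob (tilt v mu).
Proof.
case: Pmu => m0 m1; split=> [x|].
  by rewrite /tilt divr_ge0 ?mulr_ge0 ?expR_ge0// ltW// laplace_gt0.
by rewrite /tilt -mulr_suml divff// gt_eqF// laplace_gt0.
Qed.

Lemma KL_tilt v :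
  KL (tilt v mu) mu = dotp v (barycenter (tilt v mu)) - ln (laplace mu v).
Proof.
have Z0 := laplace_gt0 v; have [t0 t1] := tilt_prob v.
rewrite dotp_barycenter /KL /expect -[ln (laplace _ _)]mul1r -t1 mulr_suml -sumrB.
apply: eq_bigr => x _; rewrite -mulrBr {1 3}/tilt -/(laplace mu v).
have [->|mx] := eqVneq (mu x) 0; first by rewrite !mul0r.
congr (_ * _); rewrite /tilt -/(laplace mu v).
rewrite [X in ln X](_ : _ = expR (dotp v (pt R x)) / laplace mu v).
  by rewrite ln_div ?posrE ?expR_gt0// expRK.
by field; rewrite mx gt_eqF.
Qed.

(** The log-sum inequality between rho and the unnormalized tilt of mu.  Tilts give
    equality ([KL_tilt]). *)
Lemma gibbs rho v : is_prob rho -> (forall x, mu x = 0 -> rho x = 0) ->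
  dotp v (barycenter rho) - ln (laplace mu v) <= KL rho mu.
Proof.
move=> [r0 r1] ac; case: (Pmu) => m0 m1.
have : relent (\sum_x rho x) (laplace mu v) <=
       \sum_x relent (rho x) (mu x * expR (dotp v (pt R x))).
  apply: log_sum => x _; rewrite ?mulr_ge0 ?expR_ge0//.
  by move/eqP; rewrite mulf_eq0 (gt_eqF (expR_gt0 _)) orbF => /eqP; apply: ac.
rewrite r1 /relent mul1r div1r lnV ?posrE ?laplace_gt0// => le1.
rewrite dotp_barycenter KL_relent addrC -lerBrDr; apply: le_trans le1 _.
rewrite -sumrB; apply: ler_sum => x _; rewrite /relent.
have [->|rx] := eqVneq (rho x) 0; first by rewrite !mul0r subrr.
have mx : mu x != 0 by apply: contra_neq rx => /ac.
have mx0 : 0 < mu x by rewrite lt_neqAle eq_sym mx m0.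
have rx0 : 0 < rho x by rewrite lt_neqAle eq_sym rx r0.
rewrite !ln_div ?posrE ?mulr_gt0 ?expR_gt0// lnM ?posrE ?expR_gt0// expRK; lra.
Qed.

Lemma KL_ge0 rho : is_prob rho -> (forall x, mu x = 0 -> rho x = 0) ->
  0 <= KL rho mu.
Proof.
move=> Pr ac; apply: le_trans (gibbs 0 Pr ac).
rewrite dotp0l add0r -ln1 /laplace /expect.
under eq_bigr do rewrite dotp0l expR0 mulr1.
by case: Pmu => _ ->; rewrite ln1 oppr0.
Qed.

(** From 1 - z <= exp (- z) and (1 - z) (1 + z + 2 z^2) = 1 + z^2 (1 - 2 z). *)
Lemma expR_le_quad (z : R) : z <= 1 / 2 -> expR z <= 1 + z + 2 * z ^+ 2.
Proof.
move=> z1; have /= := expR_ge1Dx (- z); rewrite expRN => h.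
have zp : 0 < 1 - z by lra.
have : expR z <= (1 - z)^-1.
  by rewrite -[expR z]invrK lef_pV2 ?posrE// invr_gt0 expR_gt0.
move=> /le_trans; apply; rewrite -div1r ler_pdivrMr//.
rewrite expr2; nra.
Qed.

(** Smoothness of the log-Laplace transform along a coordinate: its derivative is
    the barycenter of the tilt, and the entries +-1 of the points bound the second
    order term. *)
Lemma ln_laplace_step v i (h : R) : `|h| <= 1 / 2 ->
  ln (laplace mu (v + h *: delta_mx 0 i)) <=
  ln (laplace mu v) + h * barycenter (tilt v mu) 0 i + 2 * h ^+ 2.
Proof.
move=> hb; have Z0 := laplace_gt0 v; have [t0 t1] := tilt_prob v.
set b := barycenter _ 0 i.
have le1 : laplace mu (v + h *: delta_mx 0 i)
           <= laplace mu v * (1 + (h * b + 2 * h ^+ 2)).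
  have -> : laplace mu (v + h *: delta_mx 0 i) =
      laplace mu v * expect (tilt v mu) (fun x => expR (h * pt R x 0 i)).
    rewrite /expect mulr_sumr; apply: eq_bigr => x _.
    rewrite dotpDl dotp_delta expRD /tilt -/(laplace mu v).
    by field; rewrite gt_eqF.
  rewrite ler_pM2l//.
  have -> : 1 + (h * b + 2 * h ^+ 2) =
      expect (tilt v mu) (fun x => 1 + h * pt R x 0 i + 2 * h ^+ 2).
    rewrite /expect; under [RHS]eq_bigr do rewrite !mulrDr mulr1.
    rewrite !big_split/= t1 -mulr_suml t1 mul1r addrA /b barycenterE.
    rewrite /expect mulr_sumr; congr (_ + _ + _).
    by apply: eq_bigr => x _; rewrite mulrCA.
  apply: ler_sum => x _; rewrite ler_wpM2l//.
  have -> : h ^+ 2 = (h * pt R x 0 i) ^+ 2.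
    by case: (pt_cases x i) => ->; rewrite ?mulrN1 ?sqrrN ?mulr1.
  apply: expR_le_quad; apply: le_trans hb; apply: le_trans (ler_norm _) _.
  by rewrite normrM; case: (pt_cases x i) => ->; rewrite ?normrN normr1 mulr1.
have g0 : 0 < 1 + (h * b + 2 * h ^+ 2).
  by rewrite -(pmulr_rgt0 _ Z0); apply: lt_le_trans le1; apply: laplace_gt0.
rewrite -addrA.
apply: le_trans (_ : _ <= ln (laplace mu v * (1 + (h * b + 2 * h ^+ 2)))) _.
  by rewrite ler_ln ?posrE ?mulr_gt0// laplace_gt0.
by rewrite lnM ?posrE// lerD2l le_ln1Dx//; lra.
Qed.

End Fixed.
End Tilts.

(** * Approximation of barycenters by tilts *)

Section Stability.
Variables (R : realType) (n : nat).
Implicit Types (mu rho : cube n -> R) (u v : 'rV[R]_n).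

Lemma dotpC u v : dotp u v = dotp v u :> R.
Proof. by apply: eq_bigr => i _; rewrite mulrC. Qed.

Lemma sqr_le_dotp v i : (v 0 i) ^+ 2 <= dotp v v.
Proof.
rewrite /dotp (bigD1 i)//= -expr2 lerDl sumr_ge0// => j _.
by rewrite -expr2 sqr_ge0.
Qed.

(** With G v = ln Z v - <v, b rho> + e/2 |v|^2, take v such that
    G v <= inf G + e^2.  Comparing G v with its values at v +- e e_i shows that the
    gradient b (tilt v) - b rho + e v has entries at most 4 e.  The penalty keeps
    e |v|^2 bounded, so e v, hence the distance between the barycenters, is
    O (sqrt e), while the Gibbs principle controls the relative entropy. *)
Lemma tilt_approx mu rho (d : R) : is_prob mu -> is_prob rho ->
  (forall x, mu x = 0 -> rho x = 0) -> 0 < d ->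
  exists v, KL (tilt v mu) mu <= KL rho mu + d /\
    forall i, `|barycenter (tilt v mu) 0 i - barycenter rho 0 i| <= d.
Proof.
move=> Pmu Pr ac d0; set K := KL rho mu; set B := barycenter rho.
have K0 : 0 <= K by apply: KL_ge0.
(* The four bounds serve, in this order: [expR_le_quad], the 4 e gradient error,
   the sum of n such errors in the relative entropy, and the size of e v. *)
pose e : R := Num.min (Num.min (1 / 2) (d / 8))
  (Num.min (d / (4 * n.+1%:R)) (d ^+ 2 / (8 * (1 + K)))).
have e0 : 0 < e.
  by rewrite !lt_min !divr_gt0 ?mulr_gt0 ?exprn_gt0 ?ltr0n//; lra.
have [e1 e2 e3 e4] : [/\ e <= 1 / 2, e <= d / 8, e <= d / (4 * n.+1%:R) &
    e <= d ^+ 2 / (8 * (1 + K))].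
  by have : e <= e by []; rewrite {2}/e !le_min => /andP[/andP[? ?] /andP[? ?]].
have {}e3 : 4 * e * n%:R <= d.
  rewrite ler_pdivlMr ?mulr_gt0 ?ltr0n// in e3; apply: le_trans e3.
  rewrite -natr1; nra.
have {}e4 : 8 * (e * (1 + K)) <= d ^+ 2.
  by rewrite ler_pdivlMr ?mulr_gt0// in e4; lra.
pose G v := ln (laplace mu v) - dotp v B + e / 2 * dotp v v.
have dvv0 v : 0 <= dotp v v.
  by apply: sumr_ge0 => i _; rewrite -expr2 sqr_ge0.
have Glow v : e / 2 * dotp v v - K <= G v.
  by have := gibbs Pmu v Pr ac; rewrite /G -/K -/B; lra.
have hi : has_inf (range G).
  split; first by exists (G 0), 0.
  exists (- K) => _ [v _ <-]; apply: le_trans (Glow v).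
  by have := dvv0 v; nra.
have [_ [v _ <-] Gv] := inf_adherent (exprn_gt0 2 e0) hi.
have {Gv}Gv w : G v <= G w + e ^+ 2.
  apply: le_trans (ltW Gv) _; rewrite lerD2r; apply: ge_inf; last by exists w.
  exact: hi.2.
set b := barycenter (tilt v mu).
have g_le i : `|b 0 i - B 0 i + e * v 0 i| <= 4 * e.
  have step (h : R) : h ^+ 2 = e ^+ 2 ->
      0 <= 4 * e ^+ 2 + h * (b 0 i - B 0 i + e * v 0 i).
    move=> hh.
    have hle : `|h| <= 1 / 2.
      have : `|h| ^+ 2 = `|e| ^+ 2 by rewrite !real_normK ?num_real.
      by move=> /eqP; rewrite eqrXn2// => /eqP ->; rewrite gtr0_norm.
    have := ln_laplace_step Pmu v i hle; rewrite -/b.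
    have := Gv (v + h *: delta_mx 0 i); rewrite /G !dotpDl !dotp_delta.
    rewrite (dotpC v (v + _)) dotpDl dotp_delta !mxE !eqxx/= mulr1.
    have := exprn_gt0 2 e0; rewrite -hh.
    set q := h ^+ 2; rewrite (mulrDr h) -expr2 -/q => q0.
    nra.
  have := step e erefl; have := step (- e) (sqrrN _).
  rewrite expr2 ler_norml; nra.
exists v; split; last first.
  move=> i; rewrite -/b -/B.
  have ev : `|e * v 0 i| <= d / 2.
    have := Gv 0; rewrite {2}/G !dotp0l mulr0 subr0 addr0.
    have -> : laplace mu 0 = 1.
      rewrite /laplace /expect; under eq_bigr do rewrite dotp0l expR0 mulr1.
      by case: Pmu.
    rewrite ln1 add0r => G0; have := Glow v; have := sqr_le_dotp v i => h1 h2.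
    rewrite -ler_sqr ?nnegrE ?normr_ge0//; last lra.
    rewrite real_normK ?num_real// exprMn.
    have h3 : e / 2 * v 0 i ^+ 2 <= e ^+ 2 + K.
      by have : e / 2 * v 0 i ^+ 2 <= e / 2 * dotp v v; [rewrite ler_pM2l//|]; lra.
    have h4 : e ^+ 2 <= 1 by rewrite expr2; nra.
    (* (e v_i)^2 = 2 e (e / 2 v_i^2), and e / 2 v_i^2 <= e^2 + K. *)
    have h5 : 2 * e * (e / 2 * v 0 i ^+ 2) <= 2 * e * (1 + K).
      by rewrite ler_wpM2l//; lra.
    have -> : e ^+ 2 * v 0 i ^+ 2 = 2 * e * (e / 2 * v 0 i ^+ 2) by field.
    have -> : (d / 2) ^+ 2 = d ^+ 2 / 4 by field.
    lra.
  move: (g_le i) ev; rewrite !ler_norml => /andP[? ?] /andP[? ?].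
  by apply/andP; split; lra.
rewrite KL_tilt// -/b.
have : dotp v b <= dotp v B + d.
  (* v_i (b_i - B_i) = v_i g_i - e v_i^2 <= 4 e |v_i| - e v_i^2 <= 4 e, where g is the
     gradient; the last step is e (|v_i| - 2)^2 >= 0. *)
  apply: le_trans (_ : _ <= dotp v B + \sum_(i < n) 4 * e) _; last first.
    by rewrite sumr_const card_ord lerD2l -[_ *+ n]mulr_natr.
  rewrite /dotp -big_split; apply: ler_sum => i _ /=.
  move: (g_le i); rewrite ler_norml => /andP[g1 g2].
  set c := v 0 i in g1 g2 *.
  have [c0|c0] := lerP 0 c.
    have : c * (b 0 i - B 0 i + e * c) <= c * (4 * e) by rewrite ler_wpM2l.
    have : 0 <= e * (c - 2) ^+ 2 by rewrite mulr_ge0 ?sqr_ge0// ltW.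
    rewrite expr2; lra.
  have : (- c) * - (b 0 i - B 0 i + e * c) <= (- c) * (4 * e).
    by rewrite ler_wpM2l//; lra.
  have : 0 <= e * (c + 2) ^+ 2 by rewrite mulr_ge0 ?sqr_ge0// ltW.
  rewrite expr2; lra.
have := gibbs Pmu v Pr ac; rewrite -/K -/B; lra.
Qed.

End Stability.

(** * Stability for arbitrary densities *)

Section StableDensities.
Variables (R : realType) (n : nat).
Implicit Types (mu rho : cube n -> R).

(** A tangent line at a point p > 0 is exact there.  At p = 0, where the slope is
    infinite, the minorant with parameter s = eta misses by at most eta. *)
Lemma relent_lsc (p q eta : R) : 0 <= p -> 0 < q <= 1 -> 0 < eta ->
  exists2 C : R, 0 <= C &
    forall p', 0 <= p' -> relent p q - eta - C * `|p' - p| <= relent p' q.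
Proof.
move=> p0 /andP[q0 q1] eta0.
pose s := if p == 0 then eta else p / q.
have s0 : 0 < s.
  by rewrite /s; case: eqVneq => // pn; rewrite divr_gt0// lt_neqAle eq_sym pn.
exists `|1 + ln s| => // p' p'0.
have qn : q = 0 -> p' = 0 by move=> qq; rewrite qq ltxx in q0.
apply: le_trans (relent_tangent s0 p'0 (ltW q0) qn).
have : relent p q - eta <= p * ln s + p - s * q.
  rewrite /s; case: eqVneq => [->|pn]; last first.
    by rewrite divfK ?gt_eqF// addrK /relent lerBlDr lerDl ltW.
  by rewrite relent0l mul0r !add0r lerN2 ler_piMr// ltW.
have : (1 + ln s) * (p - p') <= `|1 + ln s| * `|p' - p|.
  by rewrite (distrC p') -normrM ler_norm.
lra.
Qed.

(** The relative entropy of the laws on {-1,1} with means a and b. *)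
Definition bern_relent (a b : R) : R :=
  relent ((1 + a) / 2) ((1 + b) / 2) + relent ((1 - a) / 2) ((1 - b) / 2).

Lemma H_bern x y : H x y = \sum_(i < n | `|y 0 i| < 1) bern_relent (x 0 i) (y 0 i).
Proof.
have half (a b : R) : a / 2 / (b / 2) = a / b.
  by rewrite invf_div mulrA divfK// pnatr_eq0.
by apply: eq_bigr => i _; rewrite /bern_relent /relent !half.
Qed.

Lemma bern_relent_lsc (a b eta : R) : -1 <= a <= 1 -> `|b| < 1 -> 0 < eta ->
  exists2 C : R, 0 <= C & forall a', -1 <= a' <= 1 ->
    bern_relent a b - eta - C * `|a' - a| <= bern_relent a' b.
Proof.
move=> /andP[a1 a2]; rewrite ltr_norml => /andP[b1 b2] eta0.
have [| | |C1 C10 h1] := @relent_lsc ((1 + a) / 2) ((1 + b) / 2) (eta / 2); try lra.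
have [| | |C2 C20 h2] := @relent_lsc ((1 - a) / 2) ((1 - b) / 2) (eta / 2); try lra.
exists ((C1 + C2) / 2) => [|a' /andP[a1' a2']]; first lra.
have := h1 ((1 + a') / 2); have := h2 ((1 - a') / 2).
have -> : (1 + a') / 2 - (1 + a) / 2 = (a' - a) / 2 by field.
have -> : (1 - a') / 2 - (1 - a) / 2 = - ((a' - a) / 2) by field.
rewrite normrN normrM [`|2^-1|]gtr0_norm ?invr_gt0// /bern_relent.
move=> /(_ ltac:(lra)) e2 /(_ ltac:(lra)) e1; lra.
Qed.

(** Quantitative lower semicontinuity: the affine minorants of the coordinates,
    each with error eta / (n + 1), have a common Lipschitz constant C. *)
Lemma H_lsc (x y : 'rV[R]_n) (eta : R) :
  (forall i, -1 <= x 0 i <= 1) -> 0 < eta ->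
  exists2 C : R, 0 <= C & forall (x' : 'rV[R]_n) d,
    (forall i, -1 <= x' 0 i <= 1) -> (forall i, `|x' 0 i - x 0 i| <= d) ->
    H x y - eta - C * d <= H x' y.
Proof.
move=> x1 eta0; have e0 : 0 < eta / n.+1%:R by rewrite divr_gt0 ?ltr0n.
have /choice[C hC] : forall i, exists C : R, 0 <= C /\ (`|y 0 i| < 1 ->
    forall a', -1 <= a' <= 1 -> bern_relent (x 0 i) (y 0 i) - eta / n.+1%:R
       - C * `|a' - x 0 i| <= bern_relent a' (y 0 i)).
  move=> i; case: (boolP (`|y 0 i| < 1)) => [yi|_]; last by exists 0.
  by have [C C0 h] := bern_relent_lsc (x1 i) yi e0; exists C.
exists (\sum_(i < n | `|y 0 i| < 1) C i) => [|x' d x'1 xd].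
  by apply: sumr_ge0 => i _; case: (hC i).
apply: le_trans (_ : _ <= \sum_(i < n | `|y 0 i| < 1)
  (bern_relent (x 0 i) (y 0 i) - eta / n.+1%:R - C i * d)) _; last first.
  rewrite [H x' y]H_bern; apply: ler_sum => i yi; case: (hC i) => C0 /(_ yi) h.
  apply: le_trans (h _ (x'1 i)); rewrite lerD2l lerN2.
  by rewrite ler_wpM2l.
rewrite big_split/= big_split/= !sumrN -H_bern -!mulr_suml lerD2r lerD2l lerN2.
rewrite sumr_const -[eta *+ _]mulr_natr -mulrA ger_pMr//.
rewrite ler_pdivrMr ?ltr0n// mul1r ler_nat.
by rewrite (leq_trans (max_card _))// card_ord.
Qed.

(** Stability extends from tilts to every absolutely continuous measure: apply it to
    the tilts of [tilt_approx] and pass to the limit with [H_lsc]. *)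
Lemma stable_density kappa mu rho : 0 < kappa -> is_prob mu ->
  entropically_stable kappa (@H R n) mu -> is_prob rho ->
  (forall x, mu x = 0 -> rho x = 0) ->
  H (barycenter rho) (barycenter mu) <= kappa * KL rho mu.
Proof.
move=> k0 Pmu st Pr ac; apply/ler_addgt0Pr => eta eta0.
have e0 : 0 < eta / 2 by lra.
have [C C0 hC] := H_lsc (barycenter mu) (fun i => barycenter_itv i Pr) e0.
have d0 : 0 < eta / (2 * (C + kappa)) by rewrite divr_gt0//; lra.
have [v [KLv bv]] := tilt_approx Pmu Pr ac d0.
have := hC _ _ (fun i => barycenter_itv i (tilt_prob Pmu v)) bv.
have := st v; have := KLv; rewrite -(ler_pM2l k0).
have : (C + kappa) * (eta / (2 * (C + kappa))) = eta / 2.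
  by field; apply/eqP; lra.
lra.
Qed.

End StableDensities.

(** * Conditioning on coordinates and the one-step entropy inequality *)

Section Cylinders.
Variables (R : realType) (n : nat).
Implicit Types (mu nu : cube n -> R) (f g : cube n -> R) (S U : {set 'I_n}).

Lemma cond_ge0 nu A : (forall x, 0 <= nu x) -> forall x, 0 <= cond nu A x :> R.
Proof.
move=> n0 x; rewrite /cond; case: ifP => // _.
by rewrite divr_ge0// sumr_ge0.
Qed.

Lemma cond_prob nu (A : {set cube n}) : (forall x, 0 <= nu x) ->
  0 < mass nu A -> is_prob (cond nu A).
Proof.
move=> n0 A0; split; first exact: cond_ge0.
rewrite /cond -big_mkcond/= -mulr_suml divff// gt_eqF//.
Qed.

Lemma cond_cond nu (A B : {set cube n}) : (forall x, 0 <= nu x) ->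
  cond (cond nu A) B = cond nu (A :&: B).
Proof.
move=> n0; apply/funext => x.
have mB : mass (cond nu A) B = mass nu (A :&: B) / mass nu A.
  rewrite /mass /cond mulr_suml -big_mkcondr; apply: eq_bigl => y.
  by rewrite inE andbC.
rewrite /cond inE -/(cond nu A) mB /cond andbC; case: (x \in B) => //=.
case: (boolP (x \in A)) => xA; last by rewrite mul0r.
have [A0|A0] := eqVneq (mass nu A) 0.
  by rewrite (psumr_eq0P _ A0)// !mul0r.
by rewrite invf_div mulrA divfK.
Qed.

Definition cyl S (x : cube n) : {set cube n} :=
  [set z : cube n | [forall i, (i \in S) ==> (z i == x i)]].

Lemma cylP S (x z : cube n) : reflect (forall i, i \in S -> z i = x i) (z \in cyl S x).
Proof.
rewrite inE; apply: (iffP forallP) => h i; last first.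
  by apply/implyP => /h/eqP.
by move=> iS; have /implyP/(_ iS)/eqP := h i.
Qed.

Lemma cyl_refl S x : x \in cyl S x.
Proof. exact/cylP. Qed.

Lemma cyl_sym S x y : (x \in cyl S y) = (y \in cyl S x).
Proof. by apply/cylP/cylP => h i /h. Qed.

Lemma cyl_eq S x y : y \in cyl S x -> cyl S y = cyl S x.
Proof.
move=> /cylP h; apply/setP => z; apply/cylP/cylP => k i iS.
  by rewrite k// h.
by rewrite k// h.
Qed.

Lemma cylU1 S x y i : y \in cyl S x ->
  cyl (i |: S) y = cyl S x :&: cyl [set i] y.
Proof.
move=> /cyl_eq <-; apply/setP => z; rewrite finset.in_setI.
apply/cylP/andP => [h|[/cylP h1 /cylP h2] j].
  split; apply/cylP => j jS; apply: h; rewrite finset.in_setU1.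
    by rewrite jS orbT.
  by rewrite (finset.set1P jS) eqxx.
by rewrite finset.in_setU1 => /orP[/eqP ->|/h1//]; apply: h2; rewrite finset.set11.
Qed.

Lemma cyl0 x : cyl finset.set0 x = finset.setT.
Proof.
apply/setP => z; rewrite finset.in_setT; apply/cylP => i.
by rewrite finset.in_set0.
Qed.

Lemma mass_cyl_gt0 nu S x : (forall y, 0 <= nu y) -> 0 < nu x ->
  0 < mass nu (cyl S x).
Proof.
move=> n0 nx; rewrite /mass (bigD1 x)/= ?cyl_refl//.
by rewrite ltr_wpDr// sumr_ge0.
Qed.

Definition cexp mu S f (x : cube n) : R := expect (cond mu (cyl S x)) f.

(** The relation of lying in the same S-cylinder is symmetric, so exchanging the two
    sums leaves for each y the factor (sum of mu over cyl S y) / mass (cyl S y) = 1. *)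
Lemma tower mu S f : (forall x, 0 <= mu x) ->
  expect mu (cexp mu S f) = expect mu f.
Proof.
move=> m0; rewrite /cexp /expect.
under eq_bigr do rewrite mulr_sumr.
rewrite exchange_big; apply: eq_bigr => y _ /=.
have [my|my] := eqVneq (mu y) 0.
  rewrite my mul0r big1// => x _; rewrite /cond my.
  by case: ifP => _; rewrite ?mul0r ?mulr0// mul0r mulr0.
have M0 : 0 < mass mu (cyl S y).
  by apply: mass_cyl_gt0; rewrite // lt_neqAle eq_sym my m0.
transitivity (\sum_(x in cyl S y) mu x * (mu y / mass mu (cyl S y) * f y)).
  rewrite [RHS]big_mkcond; apply: eq_bigr => x _; rewrite /cond cyl_sym.
  case: ifP => [xy|]; last by rewrite mul0r mulr0.
  by rewrite (cyl_eq xy).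
by rewrite -mulr_suml -/(mass mu _); field; rewrite gt_eqF.
Qed.

(** Both sides equal E[f ln f] - E[f] ln E[f]: apply the tower property to f ln f
    and to f. *)
Lemma chain_rule mu S f : (forall x, 0 <= mu x) ->
  Ent mu f = Ent mu (cexp mu S f)
             + expect mu (fun x => Ent (cond mu (cyl S x)) f).
Proof.
move=> m0; rewrite /Ent (tower S f m0).
rewrite -(tower S (fun x => f x * ln (f x)) m0) /cexp /expect.
under [X in _ = _ + X]eq_bigr do rewrite mulrBr.
by rewrite sumrB; ring.
Qed.

Lemma expect_Ent_ge0 mu S f : is_prob mu -> (forall x, 0 <= f x) ->
  0 <= expect mu (fun x => Ent (cond mu (cyl S x)) f).
Proof.
move=> [m0 m1] f0; apply: sumr_ge0 => x _.
have [->|mx] := eqVneq (mu x) 0; first by rewrite mul0r.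
rewrite mulr_ge0// Ent_ge0//; apply: cond_prob => //; apply: mass_cyl_gt0 => //.
by rewrite lt_neqAle eq_sym mx m0.
Qed.

Lemma marginal mu i (b : bool) : is_prob mu ->
  \sum_(x : cube n | x i == b) mu x = (1 + (if b then 1 else -1) * barycenter mu 0 i) / 2.
Proof.
move=> [m0 m1]; rewrite -[X in X + _]m1 barycenterE /expect mulr_sumr.
rewrite -big_split/= mulr_suml.
rewrite big_mkcond; apply: eq_bigr => x _; rewrite mxE.
by case: (x i); case: b => /=; field.
Qed.

Definition density_measure mu f (x : cube n) : R := mu x * f x / expect mu f.

Lemma density_measure_prob mu f : (forall x, 0 <= mu x) ->
  (forall x, 0 <= f x) -> expect mu f != 0 -> is_prob (density_measure mu f).
Proof.
move=> m0 f0 E0; split => [x|].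
  by rewrite /density_measure divr_ge0 ?mulr_ge0 ?expect_ge0.
by rewrite /density_measure -mulr_suml divff.
Qed.

Lemma KL_density mu f : (forall x, 0 <= mu x) -> (forall x, 0 <= f x) ->
  expect mu f != 0 ->
  Ent mu f = expect mu f * KL (density_measure mu f) mu.
Proof.
move=> m0 f0 E0; rewrite Ent_relent// KL_relent mulr_sumr.
apply: eq_bigr => x _; rewrite -relent_scale ?expect_ge0//.
by rewrite /density_measure [expect mu f * (_ / _)]mulrC divfK// [expect mu f * _]mulrC.
Qed.

(** Grouping the points according to x_i turns the entropy of E[f | x_i] into a sum
    over the two values of x_i, with the marginals of mu and of the measure
    of density f / E f.  A marginal has weights (1 +- b_i) / 2. *)
Lemma Ent_cexp1 mu f i : is_prob mu -> (forall x, 0 <= f x) ->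
  expect mu f != 0 ->
  Ent mu (cexp mu [set i] f) = expect mu f *
    bern_relent (barycenter (density_measure mu f) 0 i) (barycenter mu 0 i).
Proof.
move=> Pmu f0 E0; have [m0 m1] := Pmu.
set rho := density_measure mu f; set E := expect mu f.
have Pr : is_prob rho by apply: density_measure_prob.
have Ep : 0 <= E by apply: expect_ge0.
have cylE x : cyl [set i] x = [set z : cube n | z i == x i].
  apply/setP => z; rewrite [RHS]inE; apply/cylP/eqP => [h|h j].
    by apply: h; rewrite finset.set11.
  by move=> /finset.set1P ->.
pose m b := \sum_(x : cube n | x i == b) mu x.
pose F b := \sum_(x : cube n | x i == b) mu x * f x.
have cE x : cexp mu [set i] f x = F (x i) / m (x i).
  rewrite /cexp cylE /expect /cond /F mulr_suml [RHS]big_mkcond.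
  apply: eq_bigr => z _; rewrite inE.
  case: ifP => _; last by rewrite mul0r.
  rewrite mulrAC; congr (_ / _); apply: eq_bigl => y; by rewrite inE.
rewrite Ent_relent//; last first.
  by move=> x; apply: expect_ge0 => // y; apply: cond_ge0.
rewrite tower// -/E (partition_big (fun x : cube n => x i) xpredT)//=.
have mb b : \sum_(x : cube n | x i == b) relent (mu x * cexp mu [set i] f x) (mu x * E)
    = E * relent (F b / E) (m b).
  transitivity (\sum_(x : cube n | x i == b) mu x * relent (F b / m b) E).
    by apply: eq_bigr => x /eqP xb; rewrite relent_scale// cE xb.
  rewrite -mulr_suml -/(m b) -!relent_scale//; last first.
    by apply: sumr_ge0.
  rewrite [E * (_ / E)]mulrC divfK//.
  have [mb0|mb0] := eqVneq (m b) 0; last by rewrite [m b * (_ / _)]mulrC divfK// mulrC.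
  suff -> : F b = 0 by rewrite mul0r mulr0 !relent0l.
  by rewrite /F big1// => x xb; rewrite (psumr_eq0P _ mb0)// mul0r.
rewrite big_bool/= !mb -mulrDr /bern_relent.
have Fb b : F b / E = \sum_(x : cube n | x i == b) rho x by rewrite /F mulr_suml.
by rewrite !Fb /m !marginal// !mul1r !mulN1r.
Qed.

(** H omits the coordinates that are constant under mu.  They contribute nothing:
    rho << mu is constant there too. *)
Lemma barycenter_extreme mu rho i : is_prob mu -> is_prob rho ->
  (forall x, mu x = 0 -> rho x = 0) -> ~~ (`|barycenter mu 0 i| < 1) ->
  bern_relent (barycenter rho 0 i) (barycenter mu 0 i) = 0.
Proof.
move=> Pmu Pr ac; have [m0 m1] := Pmu.
have rel11 : relent 1 1 = 0 :> R by rewrite /relent divr1 ln1 mulr0.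
have vanish b : \sum_(x : cube n | x i == b) mu x = 0 ->
    \sum_(x : cube n | x i == b) rho x = 0.
  by move=> mb; rewrite big1// => x xb; apply: ac; rewrite (psumr_eq0P _ mb).
have := barycenter_itv i Pmu; rewrite ltr_norml => /andP[b1 b2].
have two : (1 + 1) / 2 = 1 :> R by field.
rewrite negb_and -!leNgt => /orP[b3|b3].
  have bm : barycenter mu 0 i = -1 by apply/eqP; rewrite eq_le b3 b1.
  have := @vanish true; rewrite !marginal// bm mul1r subrr mul0r mul1r => /(_ erefl) h.
  have br : barycenter rho 0 i = -1 by lra.
  by rewrite br /bern_relent subrr mul0r relent0l opprK two rel11 addr0.
have bm : barycenter mu 0 i = 1 by apply/eqP; rewrite eq_le b3 b2.
have := @vanish false; rewrite !marginal// bm !mulN1r subrr mul0r => /(_ erefl) h.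
have br : barycenter rho 0 i = 1 by lra.
by rewrite br /bern_relent subrr mul0r relent0l two rel11 addr0.
Qed.

(** The key inequality: single coordinates explain in total at most kappa times the
    entropy of f. *)
Lemma sum_Ent_cexp1 kappa mu f : 0 < kappa -> is_prob mu ->
  entropically_stable kappa (@H R n) mu -> (forall x, 0 <= f x) ->
  expect mu f != 0 ->
  \sum_i Ent mu (cexp mu [set i] f) <= kappa * Ent mu f.
Proof.
move=> k0 Pmu st f0 E0; have [m0 m1] := Pmu.
have Pr := density_measure_prob m0 f0 E0.
have ac x : mu x = 0 -> density_measure mu f x = 0.
  by move=> mx; rewrite /density_measure mx !mul0r.
under eq_bigr do rewrite Ent_cexp1//.
rewrite -mulr_sumr KL_density// mulrCA ler_wpM2l ?expect_ge0//.
apply: le_trans (stable_density k0 Pmu st Pr ac); rewrite H_bern.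
rewrite [X in _ <= X]big_mkcond/=; apply: ler_sum => i _.
by case: ifP => // /negbT h; rewrite barycenter_extreme.
Qed.

(** By the chain rule the right-hand side is #|U| Ent f minus the entropies explained
    by the coordinates of U. *)
Lemma one_site_step kappa mu f U : 0 < kappa -> is_prob mu ->
  entropically_stable kappa (@H R n) mu -> (forall x, 0 <= f x) ->
  (#|U|%:R - kappa) * Ent mu f <=
  \sum_(i in U) expect mu (fun x => Ent (cond mu (cyl [set i] x)) f).
Proof.
move=> k0 Pmu st f0; have [m0 m1] := Pmu.
have [E0|E0] := eqVneq (expect mu f) 0.
  rewrite Ent_relent// big1 ?mulr0; last first.
    by move=> x _; rewrite (expect_eq0 m0 f0 E0) relent0l.
  by apply: sumr_ge0 => i _; apply: expect_Ent_ge0.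
have -> : \sum_(i in U) expect mu (fun x => Ent (cond mu (cyl [set i] x)) f)
    = #|U|%:R * Ent mu f - \sum_(i in U) Ent mu (cexp mu [set i] f).
  rewrite mulr_natl -sumr_const -sumrB; apply: eq_bigr => i _.
  by rewrite (chain_rule [set i] f m0) addrC addKr.
rewrite mulrBl lerD2l lerN2; apply: le_trans (sum_Ent_cexp1 k0 Pmu st f0 E0).
rewrite [X in _ <= X](bigID (mem U))/= lerDl sumr_ge0// => i _.
apply: Ent_ge0 => // x; apply: expect_ge0 => // y; exact: cond_ge0.
Qed.

(** [one_site_step] for mu = nu given x_S and U = ~: S: conditioning mu on one more
    coordinate conditions nu on i |: S. *)
Lemma local_step kappa nu f S x : 0 < kappa -> (forall y, 0 <= nu y) ->
  0 < nu x -> entropically_stable kappa (@H R n) (cond nu (cyl S x)) ->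
  (forall y, 0 <= f y) ->
  (#|~: S|%:R - kappa) * Ent (cond nu (cyl S x)) f <=
  \sum_(i in ~: S) cexp nu S (fun y => Ent (cond nu (cyl (i |: S) y)) f) x.
Proof.
move=> k0 n0 nx st f0; set mu := cond nu _.
have Pmu : is_prob mu by apply: cond_prob => //; apply: mass_cyl_gt0.
apply: le_trans (one_site_step (~: S) k0 Pmu st f0) _.
apply: ler_sum => i _; rewrite /cexp -/mu /expect; apply: ler_sum => y _.
have [yx|yx] := boolP (y \in cyl S x); last by rewrite /mu /cond (negbTE yx) !mul0r.
by rewrite (cylU1 i yx) -cond_cond.
Qed.

End Cylinders.

(** * Averaging over revealed sets and the Glauber dynamics *)

Section Glauber.
Variables (R : realType) (n : nat) (nu f : cube n -> R) (kappa : R).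
Hypothesis (Pnu : is_prob nu) (f0 : forall x, 0 <= f x) (k0 : 0 < kappa).
Implicit Types S A : {set 'I_n}.

Definition locent S : R := expect nu (fun x => Ent (cond nu (cyl S x)) f).

Lemma locent_ge0 S : 0 <= locent S.
Proof. exact: expect_Ent_ge0. Qed.

Lemma cylT_cond : cond nu finset.setT = nu.
Proof.
apply/funext => x; rewrite /cond finset.in_setT.
rewrite (_ : mass _ _ = 1) ?divr1//; case: Pnu => _ <-.
by apply: eq_bigl => y; rewrite finset.in_setT.
Qed.

Lemma locent0 : locent finset.set0 = Ent nu f.
Proof.
rewrite /locent /expect; under eq_bigr do rewrite cyl0 cylT_cond.
by rewrite -mulr_suml; case: Pnu => _ ->; rewrite mul1r.
Qed.

(** Double counting: a set of t + 1 elements arises t + 1 times by adding a point to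
    a t-set. *)
Lemma sum_add_point (t : nat) (h : {set 'I_n} -> R) :
  \sum_(S : {set 'I_n} | #|S| == t) \sum_(i in ~: S) h (i |: S)
  = t.+1%:R * \sum_(S : {set 'I_n} | #|S| == t.+1) h S.
Proof.
rewrite (exchange_big_dep xpredT)//= mulr_sumr.
transitivity (\sum_(i : 'I_n) \sum_(S : {set 'I_n} | (#|S| == t.+1) && (i \in S)) h S).
  apply: eq_bigr => i _.
  rewrite [RHS](reindex_onto (fun S => i |: S) (fun S => S :\ i)); last first.
    by move=> S /andP[_ iS]; rewrite finset.setD1K.
  apply: eq_bigl => S; rewrite finset.in_setC finset.setU11 andbT.
  have [iS|iS] := boolP (i \in S).
    rewrite andbF; apply/esym/negP => /andP[_ /eqP e].
    by move: iS; rewrite -e !inE eqxx.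
  by rewrite cardsU1 iS finset.setU1K// eqxx !andbT add1n eqSS.
rewrite (exchange_big_dep (fun S : {set 'I_n} => #|S| == t.+1))/=; last first.
  by move=> i S _ /andP[].
apply: eq_bigr => S /eqP cS.
under eq_bigl do rewrite cS eqxx.
by rewrite sumr_const cS mulr_natl.
Qed.

Definition avg_locent (t : nat) : R :=
  (\sum_(S : {set 'I_n} | #|S| == t) locent S) / 'C(n, t)%:R.

Lemma avg_locent0 : avg_locent 0 = Ent nu f.
Proof.
rewrite /avg_locent bin0 divr1.
by under eq_bigl do rewrite cards_eq0; rewrite big_pred1_eq locent0.
Qed.

Lemma avg_locent_ge0 t : 0 <= avg_locent t.
Proof. by rewrite divr_ge0// sumr_ge0// => S _; apply: locent_ge0. Qed.

Hypothesis stable : forall S x, 0 < nu x ->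
  entropically_stable kappa (@H R n) (cond nu (cyl S x)).

Lemma locent_step S :
  (#|~: S|%:R - kappa) * locent S <= \sum_(i in ~: S) locent (i |: S).
Proof.
have [n0 n1] := Pnu.
have -> : \sum_(i in ~: S) locent (i |: S) = \sum_x nu x *
    \sum_(i in ~: S) cexp nu S (fun y => Ent (cond nu (cyl (i |: S) y)) f) x.
  under eq_bigr do rewrite /locent -(tower S) //.
  rewrite exchange_big; apply: eq_bigr => x _; by rewrite mulr_sumr.
rewrite /locent /expect mulr_sumr; apply: ler_sum => x _; rewrite mulrCA.
have [->|nx] := eqVneq (nu x) 0; first by rewrite !mul0r.
have nx0 : 0 < nu x by rewrite lt_neqAle eq_sym nx n0.
by rewrite ler_wpM2l//; apply: local_step => //; apply: stable.
Qed.

(** The weights match because (t + 1) C(n, t + 1) = (n - t) C(n, t). *)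
Lemma avg_locent_step t : (t < n)%N ->
  (1 - kappa / (n - t)%:R) * avg_locent t <= avg_locent t.+1.
Proof.
move=> tn; have nt0 : 0 < (n - t)%:R :> R by rewrite ltr0n subn_gt0.
have c0 : 0 < 'C(n, t)%:R :> R by rewrite ltr0n bin_gt0 ltnW.
have c1 : 0 < 'C(n, t.+1)%:R :> R by rewrite ltr0n bin_gt0.
have cE : t.+1%:R * 'C(n, t.+1)%:R = (n - t)%:R * 'C(n, t)%:R :> R.
  by rewrite -!natrM mul_bin_left.
have : ((n - t)%:R - kappa) * (\sum_(S : {set 'I_n} | #|S| == t) locent S)
    <= t.+1%:R * \sum_(S : {set 'I_n} | #|S| == t.+1) locent S.
  rewrite -sum_add_point mulr_sumr; apply: ler_sum => S /eqP cS.
  by apply: le_trans (locent_step S); rewrite cardsCs finset.setCK card_ord cS.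
have -> : \sum_(S : {set 'I_n} | #|S| == t) locent S = avg_locent t * 'C(n, t)%:R.
  by rewrite divfK ?gt_eqF.
have -> : \sum_(S : {set 'I_n} | #|S| == t.+1) locent S
    = avg_locent t.+1 * 'C(n, t.+1)%:R by rewrite divfK ?gt_eqF.
rewrite (mulrCA t.+1%:R) cE.
rewrite [X in _ <= X](_ : _ = ((n - t)%:R * 'C(n, t)%:R) * avg_locent t.+1); last by ring.
rewrite [X in X <= _](_ : _ = ((n - t)%:R * 'C(n, t)%:R)
   * ((1 - kappa / (n - t)%:R) * avg_locent t)); last first.
  by field; rewrite gt_eqF.
by rewrite ler_pM2l// mulr_gt0.
Qed.

(** The positive parts are what the induction can carry: a negative factor only
    gives the bound D_(t+1) >= 0. *)
Lemma avg_locent_prod t : (t <= n)%N ->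
  (\prod_(0 <= i < t) Num.max 0 (1 - kappa / (n - i)%:R)) * Ent nu f
    <= avg_locent t.
Proof.
elim: t => [_|t IH tn]; first by rewrite big_geq// mul1r avg_locent0.
rewrite big_nat_recr//= mulrAC mulrC.
set a := 1 - _; apply: le_trans (_ : _ <= Num.max 0 a * avg_locent t) _.
  by rewrite ler_wpM2l ?le_max ?lexx// IH// ltnW.
rewrite maxEle; case: ifP => _; first exact: avg_locent_step.
by rewrite mul0r avg_locent_ge0.
Qed.

(** The kernel averages the conditional expectations given x_(~: A), |A| = l.
    Convexity bounds the entropy of the average, and the chain rule turns each
    term into Ent f - locent (~: A). *)
Lemma Ent_glauber l : (l <= n)%N ->
  Ent nu (kernel_app (glauber l nu) f) <= Ent nu f - avg_locent (n - l).
Proof.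
move=> ln; have [n0 n1] := Pnu.
have c0 : 0 < 'C(n, l)%:R :> R by rewrite ltr0n bin_gt0.
pose w A : R := if #|A| == l then ('C(n, l)%:R)^-1 else 0.
have w0 A : 0 <= w A by rewrite /w; case: ifP => // _; rewrite invr_ge0.
have -> : kernel_app (glauber l nu) f
    = fun x => \sum_A w A * cexp nu (~: A) f x.
  apply/funext => x; rewrite /kernel_app /expect /glauber.
  under eq_bigr do rewrite -mulrA mulr_suml mulr_sumr.
  rewrite exchange_big /= big_mkcond /=; apply: eq_bigr => A _.
  rewrite /w; case: ifP => _; last by rewrite mul0r.
  rewrite /cexp /expect mulr_sumr; apply: eq_bigr => y _.
  have -> : [set z : cube n | [forall i, (i \notin A) ==> (z i == x i)]] = cyl (~: A) x.
    apply/finset.setP => z; rewrite !inE; apply: eq_forallb => i.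
    by rewrite finset.in_setC.
  by [].
apply: le_trans (Ent_convex _ _ _) _ => //.
  by move=> A x; apply: expect_ge0 => //; apply: cond_ge0.
have wl : \sum_A w A = 1.
  rewrite -big_mkcond sumr_const (_ : #|_| = 'C(n, l)); last first.
    have := card_draws 'I_n l; rewrite card_ord => <-.
    by apply: eq_card => A; rewrite !inE.
  by rewrite -[LHS]mulr_natl divff// gt_eqF.
rewrite (eq_bigr (fun A => w A * Ent nu f - w A * locent (~: A))); last first.
  by move=> A _; rewrite (chain_rule (~: A) f n0) -mulrBr -/(locent _) addrK.
rewrite sumrB -mulr_suml wl mul1r lerD2l lerN2 /avg_locent.
rewrite bin_sub// mulrC mulr_sumr (reindex_inj (@finset.setC_inj _))/=.
rewrite [X in _ <= X](eq_bigr (fun A =>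
  if #|A| == l then 'C(n, l)%:R^-1 * locent (~: A) else 0)); last first.
  by move=> A _; rewrite /w; case: ifP; rewrite ?mul0r.
rewrite -big_mkcond le_eqVlt; apply/orP; left; apply/eqP; apply: eq_bigl => A.
have := cardsC A; rewrite card_ord => cA; apply/eqP/eqP => h.
  by apply/eqP; rewrite -(eqn_add2r #|~: A|) cA h subnKC.
by apply/eqP; rewrite -(eqn_add2l #|A|) cA h subnKC.
Qed.

Lemma Ent_glauber_contract l : (l <= n)%N ->
  Ent nu (kernel_app (glauber l nu) f) <=
  (1 - \prod_(0 <= i < n - l) Num.max 0 (1 - kappa / (n - i)%:R)) * Ent nu f.
Proof.
move=> ln; apply: le_trans (Ent_glauber ln) _.
by rewrite mulrBl mul1r lerD2l lerN2; apply: avg_locent_prod; rewrite leq_subr.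
Qed.

End Glauber.

Section Pinnings.
Variables (R : realType) (n : nat) (nu : cube n -> R).

Definition pin_vector (S : {set 'I_n}) (x : cube n) : 'rV[R]_n :=
  \row_i (if i \in S then pt R x 0 i else 0).

Lemma pin_vector_entry S x i : pin_vector S x 0 i \in [:: -1; 0; 1].
Proof.
rewrite !mxE; case: ifP => _; last by rewrite !inE eqxx orbT.
by case: (x i); rewrite !inE eqxx ?orbT.
Qed.

Lemma pin_set_cyl S x : pin_set (pin_vector S x) = cyl S x.
Proof.
apply/finset.setP => z; rewrite !inE; apply: eq_forallb => i; rewrite !mxE.
case: (i \in S); last by rewrite mulr0 lexx.
by case: (x i); case: (z i); rewrite /= ?mulrN1 ?mulr1 ?opprK ?ler01 ?oppr_ge0 ?ler10.
Qed.

Lemma stable_cylinders kappa : (forall x, 0 <= nu x) ->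
  (forall u : 'rV[R]_n, (forall i, u 0 i \in [:: -1; 0; 1]) ->
      0 < mass nu (pin_set u) ->
      entropically_stable kappa (@H R n) (pinning u nu)) ->
  forall S x, 0 < nu x -> entropically_stable kappa (@H R n) (cond nu (cyl S x)).
Proof.
move=> n0 st S x nx; rewrite -pin_set_cyl; apply: st => [i|].
  exact: pin_vector_entry.
by rewrite pin_set_cyl; apply: mass_cyl_gt0.
Qed.

End Pinnings.

Lemma glauber_mlsi (R : realType) n (nu : cube n -> R) kappa l :
  is_prob nu -> 0 < kappa ->
  (forall S x, 0 < nu x -> entropically_stable kappa (@H R n) (cond nu (cyl S x))) ->
  (l <= n)%N ->
  ((\prod_(0 <= i < n - l) Num.max 0 (1 - kappa / (n - i)%:R))%:E
      <= mlsi (glauber l nu) nu)%E.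
Proof.
move=> Pnu k0 st ln; set p := \prod_(_ <= _ < _) _.
rewrite /mlsi (_ : p%:E = (1 - (1 - p)%:E)%E); last first.
  by rewrite -EFinB opprB addrC subrK.
apply: leeB => //; apply: ge_ereal_sup => _ [f [f0 fE] <-].
by rewrite lee_fin ler_pdivrMr// Ent_glauber_contract.
Qed.

(** * The localization process *)

Section Revealed.
Variables (R : realType) (n : nat) (nu : cube n -> R).
Hypothesis n0 : forall x, 0 <= nu x.
Implicit Types (t : nat) (k : {perm 'I_n}) (w : outcome n).

Definition agree t k : {set {perm 'I_n}} :=
  [set k' : {perm 'I_n} | [forall j : 'I_n, (j < t)%N ==> (k' j == k j)]].

Definition revealed t k : {set 'I_n} :=
  [set k j | j in [set j : 'I_n | (j < t)%N]].

Lemma agreeP t k k' :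
  reflect (forall j : 'I_n, (j < t)%N -> k' j = k j) (k' \in agree t k).
Proof.
rewrite inE; apply: (iffP forallP) => h j; last by apply/implyP => /h/eqP.
by move=> jt; have /implyP/(_ jt)/eqP := h j.
Qed.

Lemma agree_refl t k : k \in agree t k.
Proof. exact/agreeP. Qed.

Lemma card_agree_gt0 t k : 0 < #|agree t k|%:R :> R.
Proof. by rewrite ltr0n card_gt0; apply/finset.set0Pn; exists k; apply: agree_refl. Qed.

Lemma mem_revealed t k (j : 'I_n) : (k j \in revealed t k) = (j < t)%N.
Proof.
rewrite /revealed mem_imset ?inE//; exact: perm_inj.
Qed.

Lemma revealed_agree t k k' : k' \in agree t k -> revealed t k' = revealed t k.
Proof.
by move=> /agreeP h; apply: eq_in_imset => j; rewrite inE => /h.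
Qed.

Lemma card_revealed t k : (t <= n)%N -> #|revealed t k| = t.
Proof.
move=> tn; rewrite /revealed card_imset; last exact: perm_inj.
rewrite -sum1_card (eq_bigl (fun j : 'I_n => (j < t)%N)); last first.
  by move=> j; rewrite inE.
by rewrite big_ord_narrow// big_const_ord iter_addn_0 mul1n.
Qed.

Lemma revealedS (t : 'I_n) k : revealed t.+1 k = k t |: revealed t k.
Proof.
apply/finset.setP => i; rewrite -[i](permKV k) finset.in_setU1 !mem_revealed.
by rewrite (inj_eq perm_inj) ltnS leq_eqVlt.
Qed.

(** Composing with the transposition of two hidden coordinates i and i' exchanges the
    orders that continue with i and those that continue with i'. *)
Lemma next_uniform (t : 'I_n) k (h : 'I_n -> R) :
  (n - t)%:R * \sum_(k' in agree t k) h (k' t)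
  = #|agree t k|%:R * \sum_(i in ~: revealed t k) h i.
Proof.
pose c i := #|[set k' in agree t k | k' t == i]|.
have toC k' : k' \in agree t k -> k' t \in ~: revealed t k.
  by move=> kk'; rewrite finset.in_setC -(revealed_agree kk') mem_revealed ltnn.
have cE i i' : i \in ~: revealed t k -> i' \in ~: revealed t k -> c i = c i'.
  move=> iS i'S; rewrite /c.
  rewrite -!sum1_card [LHS](reindex_inj (mulIg (tperm i i'))).
  apply: eq_bigl => k'.
  have fixed (j : 'I_n) : (j < t)%N -> tperm i i' (k j) = k j.
    move=> jt; rewrite tpermD//; apply/eqP => e.
      by move: iS; rewrite finset.in_setC e mem_revealed jt.
    by move: i'S; rewrite finset.in_setC e mem_revealed jt.
  rewrite [LHS]finset.in_set [RHS]finset.in_set permM.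
  rewrite -[X in _ == X](tpermR i i') (inj_eq perm_inj).
  congr andb; apply/agreeP/agreeP => e j jt.
    by apply: (@perm_inj _ (tperm i i')); rewrite -permM e// fixed.
  by rewrite permM e// fixed.
have sumE (g : 'I_n -> R) : \sum_(k' in agree t k) g (k' t)
    = (c (k t))%:R * \sum_(i in ~: revealed t k) g i.
  rewrite (partition_big (fun k' : {perm 'I_n} => k' t) (mem (~: revealed t k)))//=.
  rewrite mulr_sumr; apply: eq_bigr => i iS.
  rewrite (eq_bigr (fun _ => g i)) => [|k' /andP[_ /eqP->]//].
  rewrite sumr_const mulr_natl (cE _ _ (toC k (agree_refl t k)) iS); congr (_ *+ _).
  by apply: eq_card => k'; rewrite [RHS]finset.in_set.
have cQ : #|agree t k|%:R = (c (k t))%:R * (n - t)%:R :> R.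
  have := sumE (fun _ => 1); rewrite !sumr_const => ->.
  by rewrite [#|~: _|]cardsCs finset.setCK card_ord card_revealed// ltnW.
by rewrite sumE cQ; ring.
Qed.

Lemma mem_info t w k x : (t <= n)%N ->
  ((k, x) \in info (t%:R : R) w)
  = (k \in agree t w.1) && (x \in cyl (revealed t w.1) w.2).
Proof.
move=> tn; rewrite !inE /nrevealed natrK (minn_idPl tn).
apply/forallP/andP => [h|[/forallP h1 /forallP h2] j].
  split; apply/forallP => j.
    by apply/implyP => jt; have := h j; rewrite jt => /andP[].
  apply/implyP => /imsetP[j']; rewrite inE => jt ->.
  by have := h j'; rewrite jt => /andP[/= /eqP ->].
apply/implyP => jt; have := h1 j; have := h2 (w.1 j).
rewrite mem_revealed jt /= => e1 /eqP e2; by rewrite e2 eqxx.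
Qed.

(** The available information is a product event and the joint law a product law:
    the order and the point remain independent. *)
Lemma cond_joint t w k x : (t <= n)%N ->
  cond (joint nu) (info (t%:R : R) w) (k, x) = (k \in agree t w.1)%:R
    / #|agree t w.1|%:R * cond nu (cyl (revealed t w.1) w.2) x.
Proof.
move=> tn; set Q := agree _ _; set C := cyl _ _.
have mE : mass (joint nu) (info (t%:R : R) w)
    = (#|{perm 'I_n}|%:R)^-1 * (#|Q|%:R * mass nu C).
  rewrite /mass (eq_bigl (fun p => (p.1 \in Q) && (p.2 \in C))); last first.
    by case=> k' x'; rewrite mem_info.
  rewrite -(pair_big (mem Q) (mem C) (fun k' x' => joint nu (k', x')))/=.
  rewrite /joint /= sumr_const -mulr_sumr.
  by rewrite -mulrnAr mulr_natl.
rewrite /cond mem_info// -/Q -/C mE /joint/=.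
case: (k \in Q); last by rewrite !mul0r.
case: (x \in C); last by rewrite mulr0.
have N0 : #|{perm 'I_n}|%:R != 0 :> R.
  by rewrite pnatr_eq0 -lt0n; apply/card_gt0P; exists 1%g.
by rewrite -mulf_div divff ?invr_eq0// !mul1r invfM mulrCA.
Qed.

Lemma cond_expect_info t w Z : (t <= n)%N ->
  cond_expect nu t%:R Z w = (#|agree t w.1|%:R)^-1 * \sum_(k in agree t w.1)
    expect (cond nu (cyl (revealed t w.1) w.2)) (fun x => Z (k, x)).
Proof.
move=> tn; rewrite /cond_expect {1}/expect.
transitivity (\sum_k \sum_x cond (joint nu) (info (t%:R : R) w) (k, x) * Z (k, x)).
  by rewrite pair_bigA; apply: eq_bigr => -[].
rewrite mulr_sumr [RHS]big_mkcond; apply: eq_bigr => k _.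
under eq_bigr do rewrite cond_joint//.
case: ifP => _; last by rewrite big1// => x _; rewrite !mul0r.
by rewrite /expect mulr_sumr; apply: eq_bigr => x _; rewrite mul1r mulrA.
Qed.

Lemma localizationE t w : (t <= n)%N ->
  localization nu t%:R w = cond nu (cyl (revealed t w.1) w.2).
Proof.
move=> tn; apply/funext => y.
have -> : localization nu t%:R w y
    = cond_expect nu t%:R (fun w' => (w'.2 == y)%:R) w.
  rewrite /localization /mass /cond_expect /expect big_mkcond.
  apply: eq_bigr => w' _; rewrite inE.
  by case: ifP => _; rewrite ?mulr1 ?mulr0.
rewrite cond_expect_info// (eq_bigr (fun _ => cond nu (cyl (revealed t w.1) w.2) y)).
  by rewrite sumr_const -[cond _ _ _ *+ _]mulr_natl mulKf// gt_eqF// card_agree_gt0.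
move=> k _; rewrite /expect (bigD1 y)//= eqxx mulr1 big1 ?addr0// => x /negbTE ->.
by rewrite mulr0.
Qed.

Lemma localization_step kappa t w f : 0 < kappa -> (t < n)%N ->
  0 < joint nu w ->
  entropically_stable kappa (@H R n) (localization nu t%:R w) ->
  (forall x, 0 <= f x) ->
  (1 - kappa / (n - t)%:R) * Ent (localization nu t%:R w) f
  <= cond_expect nu t%:R (fun w' => Ent (localization nu (t.+1)%:R w') f) w.
Proof.
move=> kap0 tn jw; rewrite localizationE ?(ltnW tn)// => st f0.
have nw : 0 < nu w.2.
  by move: jw; rewrite /joint pmulr_rgt0// invr_gt0 ltr0n; apply/card_gt0P; exists 1%g.
have m0 : 0 < (n - t)%:R :> R by rewrite ltr0n subn_gt0.
have := local_step kap0 n0 nw st f0.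
rewrite [#|~: _|]cardsCs finset.setCK card_ord card_revealed ?(ltnW tn)//.
set S := revealed t w.1; set mu := cond nu _ => step.
pose h i := cexp nu S (fun y => Ent (cond nu (cyl (i |: S) y)) f) w.2.
rewrite cond_expect_info ?(ltnW tn)//.
rewrite (eq_bigr (fun k : {perm 'I_n} => h (k (Ordinal tn)))); last first.
  move=> k kw; apply: eq_bigr => x _; rewrite localizationE//.
  by rewrite (revealedS (Ordinal tn)) (revealed_agree kw).
have Q0 := card_agree_gt0 t w.1.
have := next_uniform (Ordinal tn) w.1 h; rewrite -/S /= => nx.
rewrite ler_pdivlMl// -(ler_pM2l m0) nx mulrCA ler_pM2l//.
apply: le_trans step; rewrite mulrA (_ : _ * (1 - _) = (n - t)%:R - kappa)//.
by field; rewrite gt_eqF.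
Qed.

End Revealed.

(** * Entropy conservation along the localization *)

(* In the second part the factors are read as positive parts: with two negative
   factors the plain product can exceed 1 >= rho (uniform measure, n = 3,
   l = 1, kappa = 8). *)
Theorem proposition35 (R : realType) (n : nat) (nu : cube n -> R) (kappa : R)
    (hnu : is_prob nu) (hkappa : 0 < kappa) :
  (forall (t : nat) (w : outcome n), (t < n)%N -> 0 < joint nu w ->
     entropically_stable kappa (@H R n) (localization nu t%:R w) ->
     forall f : cube n -> R, (forall x, 0 <= f x) ->
       (1 - kappa / (n - t)%:R) * Ent (localization nu t%:R w) f
       <= cond_expect nu t%:R
            (fun w' => Ent (localization nu (t.+1)%:R w') f) w)
  /\
  ((forall u : 'rV[R]_n, (forall i, u 0 i \in [:: -1; 0; 1]) ->
      0 < mass nu (pin_set u) ->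
      entropically_stable kappa (@H R n) (pinning u nu)) ->
   forall l : nat, (1 <= l <= n)%N ->
     ((\prod_(0 <= i < n - l) Num.max 0 (1 - kappa / (n - i)%:R))%:E
      <= mlsi (glauber l nu) nu)%E).
Proof.
split=> [t w tn jw st f f0|st l /andP[_ ln]].
  by apply: localization_step => //; case: hnu.
apply: glauber_mlsi => //; apply: stable_cylinders => //; by case: hnu.
Qed.
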